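(* Let $\mathcal{A}=\mathsf{ISP}(\mathcal{M})$ be a CT-prevariety of structures and define $\mathcal{A}_{\mathscr{T}}:=\mathsf{IS}_{\mathrm c}\mathsf{P}(\mathcal{M}_{\mathscr{T}})$. Then the following statements hold. (i) If $\mathcal{A}_{\mathscr{T}}=\mathcal{A}^{\mathrm{ct}}$, then $b(\mathbf{A})=n_{\mathcal{A}}(\mathbf{A})$ for each $\mathbf{A}\in\mathcal{A}$. (ii) If $\mathcal{A}_{\mathscr{T}}=\mathcal{A}^{\mathrm{Bt}}$, then $b_0(\mathbf{A})=n_{\mathcal{A}}(\mathbf{A})$ for each $\mathbf{A}\in\mathcal{A}$. (iii) Let $\mathbf{A}\in\mathcal{A}$. Then (a) provided $\mathcal{A}_{\mathscr{T}}\subseteq\mathcal{A}^{\mathrm{Bt}}$, we have $b_0(\mathbf{A})=n_{\mathcal{A}}(\mathbf{A})$ if and only if $b_0(\mathbf{A})\in\mathcal{A}_{\mathscr{T}}$; (b) $b(\mathbf{A})=b_0(\mathbf{A})$ if and only if $b(\mathbf{A})\in\mathcal{A}^{\mathrm{Bt}}$.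
   Context: A structure $\mathbf{A}=\langle A;G,H,R\rangle$ is a set $A$ with a set $G$ of finitary total operations, a set $H$ of finitary partial operations and a set $R$ of finitary relations. Products are formed coordinatewise (a partial operation is defined at a tuple iff it is defined in every coordinate); a substructure is a subset closed under the operations and under the partial operations where defined, with restricted structure; homomorphisms preserve operations, relations and partial operations (where defined); embeddings are isomorphisms onto substructures. A topology on a structure is compatible with it if the relations and the domains of partial operations are topologically closed and the operations and partial operations are continuous; a topological structure is a structure with a compatible topology. All compact spaces are assumed Hausdorff. CT-prevariety: $\mathcal{M}$ is a set of structures of common signature, each $\mathbf{M}\in\mathcal{M}$ having a fixed associated compact topology $\mathscr{T}$ compatible with $\mathbf{M}$; $\mathbf{M}_{\mathscr{T}}$ denotes $\mathbf{M}$ with this topology and $\mathcal{M}_{\mathscr{T}}=\{\mathbf{M}_{\mathscr{T}}\mid\mathbf{M}\in\mathcal{M}\}$. $\mathcal{A}=\mathsf{ISP}(\mathcal{M})$ is the class of isomorphic copies of non-empty substructures of products of members of $\mathcal{M}$ (morphisms: homomorphisms). $\mathcal{A}_{\mathscr{T}}=\mathsf{IS}_{\mathrm c}\mathsf{P}(\mathcal{M}_{\mathscr{T}})$ is the class of isomorphic copies of non-empty topologically closed substructures of products of members of $\mathcal{M}_{\mathscr{T}}$ (morphisms: continuous homomorphisms). $\mathbf{B}^\flat$ is $\mathbf{B}$ with its topology forgotten. Natural extension: for $\mathbf{A}\in\mathcal{A}$, $X_{\mathbf{A}}$ is the disjoint union of the hom-sets $\mathcal{A}(\mathbf{A},\mathbf{M})$,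 $\mathbf{M}\in\mathcal{M}$; for $x\in\mathcal{A}(\mathbf{A},\mathbf{M})$, $\mathbf{Y}_x:=\mathbf{M}_{\mathscr{T}}$; $e_{\mathbf{A}}\colon\mathbf{A}\to\prod\{\mathbf{Y}_x\mid x\in X_{\mathbf{A}}\}$ is $e_{\mathbf{A}}(a)(x):=x(a)$; and $n_{\mathcal{A}}(\mathbf{A})$ is the smallest topologically closed substructure of $\prod\{\mathbf{Y}_x\mid x\in X_{\mathbf{A}}\}$ containing $e_{\mathbf{A}}(A)$. Bohr compactifications: $\mathcal{A}^{\mathrm{ct}}$ is the category of compact topological structures $\mathbf{B}$ with $\mathbf{B}^\flat\in\mathcal{A}$ and continuous homomorphisms; $\mathcal{A}^{\mathrm{Bt}}$ is its full subcategory of those whose topology is zero-dimensional (has a basis of clopen sets). The Bohr compactification $b(\mathbf{A})\in\mathcal{A}^{\mathrm{ct}}$ of $\mathbf{A}\in\mathcal{A}$ comes with an embedding $\iota_{\mathbf{A}}\colon\mathbf{A}\to b(\mathbf{A})^\flat$ such that the closed substructure generated by $\iota_{\mathbf{A}}(A)$ is $b(\mathbf{A})$, and is characterised up to isomorphism by: for every $\mathbf{B}\in\mathcal{A}^{\mathrm{ct}}$ and homomorphism $g\colon\mathbf{A}\to\mathbf{B}^\flat$ there is a unique continuous homomorphism $h\colon b(\mathbf{A})\to\mathbf{B}$ with $h\circ\iota_{\mathbf{A}}=g$. The zero-dimensional Bohr compactification $b_0(\mathbf{A})\in\mathcal{A}^{\mathrm{Bt}}$ is defined in the same way with $\mathcal{A}^{\mathrm{Bt}}$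 in place of $\mathcal{A}^{\mathrm{ct}}$. Equality between $b(\mathbf{A})$, $b_0(\mathbf{A})$, $n_{\mathcal{A}}(\mathbf{A})$ means isomorphism of topological structures commuting with the canonical embeddings of $\mathbf{A}$. *)

(* Defs.v *)
From HB Require Import structures.
From mathcomp Require Import all_boot all_classical.
From mathcomp Require Import topology.

Set Implicit Arguments.
Unset Strict Implicit.
Unset Printing Implicit Defensive.

Local Open Scope classical_set_scope.

Record signature := Signature {
  opI : Type;  opar : opI -> nat;
  popI : Type; popar : popI -> nat;
  relI : Type; relar : relI -> nat }.

(* Finitary tuples are functions from an ordinal.  A partial operation is a
   domain together with a function defined on it. *)
Record structure_on (S : signature) (T : Type) := StructureOn {
  op : forall i : opI S, ('I_(opar i) -> T) -> T;
  pdom : forall i : popI S, set ('I_(popar i) -> T);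
  pop : forall (i : popI S) (t : 'I_(popar i) -> T), pdom t -> T;
  srel : forall i : relI S, set ('I_(relar i) -> T) }.

Arguments op {S T} _ _ _.
Arguments pdom {S T} _ _ _.
Arguments pop {S T} _ [i t] _.
Arguments srel {S T} _ _ _.

Record structure (S : signature) := Structure {
  car :> Type;
  str : structure_on S car }.

Section Structures.
Context {S : signature}.
Implicit Types A B : structure S.

Definition hom A B (f : A -> B) : Prop :=
  [/\ forall (i : opI S) (t : 'I_(opar i) -> A),
        f (op (str A) i t) = op (str B) i (f \o t),
      forall (i : popI S) (t : 'I_(popar i) -> A) (d : pdom (str A) i t),
        exists d' : pdom (str B) i (f \o t),
          f (pop (str A) d) = pop (str B) d'
    & forall (i : relI S) (t : 'I_(relar i) -> A),
        srel (str A) i t -> srel (str B) i (f \o t)].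

Definition iso A B (f : A -> B) : Prop :=
  hom f /\ exists g : B -> A, [/\ hom g, cancel f g & cancel g f].

Definition prod_on (I : Type) (T : I -> Type)
    (s : forall i, structure_on S (T i)) : structure_on S (forall i, T i) :=
  {| op := fun o t j => op (s j) o (t ^~ j);
     pdom := fun p => [set t | forall j, pdom (s j) p (t ^~ j)];
     pop := fun p t d j => pop (s j) (d j);
     srel := fun r => [set t | forall j, srel (s j) r (t ^~ j)] |}.

Definition prod_str (I : Type) (K : I -> structure S) : structure S :=
  Structure (prod_on (fun i => str (K i))).

Definition subuniverse B (U : set B) : Prop :=
  (forall (i : opI S) (t : 'I_(opar i) -> B),
      (forall k, U (t k)) -> U (op (str B) i t)) /\
  (forall (i : popI S) (t : 'I_(popar i) -> B) (d : pdom (str B) i t),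
      (forall k, U (t k)) -> U (pop (str B) d)).

Section Sub.
Variables (B : structure S) (U : set B) (hU : subuniverse U).

Let sub_op i (t : 'I_(opar i) -> U) : U :=
  SigSub (mem_set (hU.1 i (val \o t) (fun k => set_valP (t k)))).

Let sub_pop i (t : 'I_(popar i) -> U) (d : pdom (str B) i (val \o t)) : U :=
  SigSub (mem_set (hU.2 i (val \o t) d (fun k => set_valP (t k)))).

Definition sub_on : structure_on S U :=
  {| op := sub_op;
     pdom := fun i => [set t | pdom (str B) i (val \o t)];
     pop := sub_pop;
     srel := fun i => [set t | srel (str B) i (val \o t)] |}.

Definition sub_str : structure S := Structure sub_on.
End Sub.

Definition embedding A B (f : A -> B) : Prop :=
  exists (U : set B) (hU : subuniverse U) (g : A -> sub_str hU),
    iso g /\ forall a, f a = val (g a).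

End Structures.

(* The underlying type of [{ptws 'I_n -> T}] is ['I_n -> T]; its topology is
   the product topology. A partial operation is continuous on its domain, with
   the topology induced by that of the set of all tuples. *)
Definition compatible (S : signature) (T : topologicalType)
    (s : structure_on S T) : Prop :=
  [/\ forall i, continuous (op s i : {ptws 'I_(opar i) -> T} -> T),
      forall i, closed (pdom s i : set {ptws 'I_(popar i) -> T}),
      forall i, continuous
        ((fun t => pop s (set_valP t)) :
           (pdom s i : set {ptws 'I_(popar i) -> T}) -> T)
    & forall i, closed (srel s i : set {ptws 'I_(relar i) -> T})].

Record topStructure (S : signature) := TopStructure {
  tcar :> topologicalType;
  tstr : structure_on S tcar;
  tcompat : compatible tstr }.

Definition flat (S : signature) (B : topStructure S) : structure S :=
  Structure (tstr B).

Section Continuity.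

Lemma comp_cont (X Y Z : topologicalType) (f : X -> Y) (g : Y -> Z) :
  continuous f -> continuous g -> continuous (g \o f).
Proof. by move=> fc gc x; apply: continuous_comp; [exact: fc | exact: gc]. Qed.

Lemma prod_topology_cont (X : topologicalType) (I : Type)
    (K : I -> topologicalType) (f : X -> prod_topology K) :
  (forall i, continuous (fun x => f x i)) -> continuous f.
Proof.
move=> fc x; apply/cvg_sup => i; move: x.
apply/(@continuousP _ (initial_topology (@^~ i))) => A [B oB <-].
by move/continuousP: (fc i) => /(_ B oB).
Qed.

Lemma prod_topology_eval (I : Type) (K : I -> topologicalType) (i : I) :
  continuous (fun f : prod_topology K => f i).
Proof.
move=> f; have /cvg_sup/(_ i) : nbhs f --> (f : prod_topology K) by [].
by move=> h A /initial_continuous/h.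
Qed.

Lemma sub_topology_cont (X T : topologicalType) (U : set T) (f : X -> U) :
  continuous (val \o f : X -> T) -> continuous f.
Proof.
move=> /continuousP fc; apply/continuousP => A [B oB <-]; exact: (fc B oB).
Qed.

Lemma sub_topology_val (T : topologicalType) (U : set T) :
  continuous (val : U -> T).
Proof. exact: (@initial_continuous U T set_val). Qed.

Lemma tuple_map_cont (n : nat) (X Y : topologicalType) (g : X -> Y) :
  continuous g ->
  continuous (fun t : {ptws 'I_n -> X} => (g \o t : {ptws 'I_n -> Y})).
Proof.
move=> gc; apply: prod_topology_cont => k.
exact (comp_cont (@prod_topology_eval _ (fun=> X) k) gc).
Qed.

Lemma closed_preim (X Y : topologicalType) (g : X -> Y) (D : set Y) :
  continuous g -> closed D -> closed (g @^-1` D).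
Proof. by move=> gc; apply: closed_comp => + _; exact: gc. Qed.

Lemma pop_cont (S : signature) (X T : topologicalType) (s : structure_on S T)
    i (D : set X) (g : X -> {ptws 'I_(popar i) -> T})
    (gD : forall x, D x -> pdom s i (g x)) :
  compatible s -> continuous g ->
  continuous (fun x : D => pop s (gD _ (set_valP x))).
Proof.
move=> [_ _ /(_ i) sc _] gc.
pose h (x : D) : (pdom s i : set {ptws 'I_(popar i) -> T}) :=
  SigSub (mem_set (gD _ (set_valP x))).
have hc : continuous h.
  apply: sub_topology_cont; exact (comp_cont (@sub_topology_val X D) gc).
have -> : (fun x : D => pop s (gD _ (set_valP x))) =
    (fun t => pop s (set_valP t)) \o h.
  by apply/funext => x /=; congr (pop s _); exact: Prop_irrelevance.
by move=> x; apply: continuous_comp; [exact: hc | exact: sc].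
Qed.

End Continuity.

Section TopStructures.
Context {S : signature}.
Implicit Types B C : topStructure S.

Lemma prod_compat (I : Type) (K : I -> topStructure S) :
  @compatible S (prod_topology (fun i => tcar (K i)))
    (prod_on (fun i => tstr (K i))).
Proof.
have coord n j : continuous
    ((fun t => t ^~ j) : {ptws 'I_n -> prod_topology (fun i => tcar (K i))} ->
                          {ptws 'I_n -> K j}).
  exact (@tuple_map_cont n (prod_topology (fun i => tcar (K i))) (K j)
           (fun f => f j) (@prod_topology_eval I (fun i => tcar (K i)) j)).
split=> i.
- apply: prod_topology_cont => j.
  have [+ _ _ _] := tcompat (K j) => /(_ i) c.
  exact (comp_cont (coord _ j) c).
- rewrite (_ : pdom _ i = \bigcap_j ((fun t => t ^~ j) @^-1` pdom (tstr (K j)) i));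
    last by apply/seteqP; split=> t /= h j; [move=> _; exact: h | exact: (h j)].
  apply: closed_bigI => j _.
  have [_ + _ _] := tcompat (K j) => /(_ i) c.
  exact: closed_preim (coord _ j) c.
- apply: prod_topology_cont => j.
  exact (@pop_cont S {ptws 'I_(popar i) -> prod_topology (fun i => tcar (K i))}
           (K j) (tstr (K j)) i
           (pdom (prod_on (fun i => tstr (K i))) i) (fun t => t ^~ j)
           (fun t h => h j) (tcompat (K j)) (coord _ j)).
- rewrite (_ : srel _ i = \bigcap_j ((fun t => t ^~ j) @^-1` srel (tstr (K j)) i));
    last by apply/seteqP; split=> t /= h j; [move=> _; exact: h | exact: (h j)].
  apply: closed_bigI => j _.
  have [_ _ _ +] := tcompat (K j) => /(_ i) c.
  exact: closed_preim (coord _ j) c.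
Qed.

Definition tprod (I : Type) (K : I -> topStructure S) : topStructure S :=
  TopStructure (prod_compat K).

Lemma sub_compat B (U : set B) (hU : subuniverse (U : set (flat B))) :
  @compatible S (U : topologicalType) (sub_on hU).
Proof.
have inc n : continuous ((fun t => val \o t) :
    {ptws 'I_n -> U} -> {ptws 'I_n -> B}).
  exact/tuple_map_cont/sub_topology_val.
have [opc domc _ relc] := tcompat B.
split=> i.
- apply: sub_topology_cont; exact (comp_cont (inc _) (opc i)).
- exact: closed_preim (inc _) (domc i).
- apply: sub_topology_cont.
  exact (@pop_cont S {ptws 'I_(popar i) -> U} B (tstr B) i (pdom (sub_on hU) i) (fun t => val \o t)
           (fun t h => h) (tcompat B) (inc _)).
- exact: closed_preim (inc _) (relc i).
Qed.

Definition tsub B (U : set B) (hU : subuniverse (U : set (flat B))) :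
  topStructure S := TopStructure (sub_compat hU).

Definition chom B C (f : B -> C) : Prop :=
  hom (f : flat B -> flat C) /\ continuous f.

Definition tiso B C (f : B -> C) : Prop :=
  chom f /\ exists g : C -> B, [/\ chom g, cancel f g & cancel g f].

(* The smallest closed substructure of [B] containing [E]. *)
Definition cgen B (E : set B) : set B :=
  [set x | forall U : set B,
      closed U -> subuniverse (U : set (flat B)) -> E `<=` U -> U x].

Lemma cgen_sub B (E : set B) : subuniverse (cgen E : set (flat B)).
Proof.
split=> [i t ht | i t d ht] U cU hU EU.
  by apply: hU.1 => k; exact: (ht k U).
by apply: hU.2 => k; exact: (ht k U).
Qed.

Lemma cgen_incl B (E : set B) : E `<=` cgen E.
Proof. by move=> x Ex U _ _; exact. Qed.

End TopStructures.

Section Prevariety.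
Context {S : signature} {J : Type}.

(* Classes of structures are predicates; the carriers of all structures live in
   one fixed universe.  The set of structures with their associated topologies is given as an
   indexed family [M]. *)
Definition ct_prevariety (M : J -> topStructure S) : Prop :=
  forall j, compact [set: M j] /\ hausdorff_space (M j).

Variable M : J -> topStructure S.

(* Products over the empty index set are allowed. *)
Definition ISP (A : structure S) : Prop :=
  exists (I : Type) (m : I -> J)
    (U : set (prod_str (fun i => flat (M (m i))))) (hU : subuniverse U)
    (f : A -> sub_str hU), U !=set0 /\ iso f.

Definition IScP (B : topStructure S) : Prop :=
  exists (I : Type) (m : I -> J)
    (U : set (tprod (fun i => M (m i))))
    (hU : subuniverse (U : set (flat (tprod (fun i => M (m i))))))
    (f : B -> tsub hU), [/\ U !=set0, closed U & tiso f].

Definition Act (B : topStructure S) : Prop :=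
  [/\ compact [set: B], hausdorff_space B & ISP (flat B)].

(* The library's [zero_dimensional] only asks that clopen sets separate
   points. *)
Definition zero_dim (T : topologicalType) : Prop :=
  exists2 D : set (set T), basis D & D `<=` clopen.

Definition ABt (B : topStructure S) : Prop := Act B /\ zero_dim B.

Section NaturalExtension.
Variable A : structure S.

Definition homset (B : structure S) : Type := {f : A -> B | hom f}.

Definition natX : Type := {j : J & homset (flat (M j))}.

Definition natY (x : natX) : topStructure S := M (projT1 x).

Definition nat_eval (a : A) : tprod natY := fun x => sval (projT2 x) a.

Definition nat_ext : topStructure S := tsub (cgen_sub (range nat_eval)).

Definition nat_emb (a : A) : nat_ext :=
  SigSub (mem_set (cgen_incl (imageT nat_eval a))).

End NaturalExtension.

End Prevariety.

Arguments nat_ext {S J} M A.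
Arguments nat_emb {S J} M A _.

Section Bohr.
Context {S : signature}.

(* [B] together with [iota] is the Bohr compactification of [A] relative to the class
   [C] of topological structures: [Act M] gives b(A), [ABt M] gives b_0(A). *)
Record bohr (C : topStructure S -> Prop) (A : structure S)
    (B : topStructure S) (iota : A -> B) : Prop := Bohr {
  bohr_in : C B;
  bohr_emb : embedding (iota : A -> flat B);
  bohr_gen : cgen (range iota) = setT;
  bohr_univ : forall B' : topStructure S, C B' ->
    forall g : A -> flat B', hom g ->
    exists! h : B -> B', chom h /\ h \o iota = g }.

(* Equality of two extensions of [A]. *)
Definition same_ext (A : structure S) (B C : topStructure S)
    (i : A -> B) (j : A -> C) : Prop :=
  exists f : B -> C, tiso f /\ f \o i = j.

End Bohr.

(* Main.v *)
Require Import Defs.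
From HB Require Import structures.
From mathcomp Require Import all_boot all_classical.
From mathcomp Require Import topology.

Set Implicit Arguments.
Unset Strict Implicit.
Unset Printing Implicit Defensive.

Local Open Scope classical_set_scope.

(** The natural extension is always the Bohr compactification of [A] relative
    to the class [IScP M]: the coordinates of a homomorphism from [A] into a
    closed substructure of a product of the [M j] are homomorphisms into the
    [M j], hence indices of the product containing the natural extension, so the
    homomorphism extends by a projection.  The rest is uniqueness of
    reflections, together with the fact that a Bohr compactification relative to
    [C] that belongs to a subclass [C'] of [C] is also one relative to [C']. *)

(** * Separation, closed images and clopen bases *)

Section Topology.

(** Neighbourhoods of [f i p] and [f i q] pull back to neighbourhoods of [p] and [q], so two points
    that cannot be separated have equal images under every [f i]. *)
Lemma hausdorff_separating (X : topologicalType) (I : Type)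
    (Y : I -> topologicalType) (f : forall i, X -> Y i) :
  (forall i, hausdorff_space (Y i)) -> (forall i, continuous (f i)) ->
  (forall x y, (forall i, f i x = f i y) -> x = y) -> hausdorff_space X.
Proof.
move=> hY fc finj p q pq; apply: finj => i; apply: (hY i) => A B Ap Bq.
have [x [Ax Bx]] := pq _ _ (fc i p A Ap) (fc i q B Bq).
by exists (f i x).
Qed.

Lemma closed_equalizer (X Y : topologicalType) (f g : X -> Y) :
  hausdorff_space Y -> continuous f -> continuous g ->
  closed [set x | f x = g x].
Proof.
move=> hY fc gc x clx; apply: hY => A B Afx Bgx.
have fA : nbhs x (f @^-1` A) := fc x A Afx.
have gB : nbhs x (g @^-1` B) := gc x B Bgx.
have [y [/= fgy [Ay By]]] := clx _ (filterI fA gB).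
by exists (f y); split=> //; rewrite fgy.
Qed.

Lemma closed_val_image (T : topologicalType) (U : set T) (V : set U) :
  closed U -> closed V -> closed [set val x | x in V].
Proof.
move=> cU /closed_openC[O oO OV].
(* The complement of [V] in [U] is the trace of the open set [O], so the image of [V] is [U] minus
   [O]. *)
rewrite (_ : [set val x | x in V] = U `&` ~` O).
  by apply: closedI => //; exact: open_closedC.
apply/seteqP; split=> [_ [x Vx <-]|y [Uy nOy]].
  split; first exact: set_valP.
  by move=> Ox; have : (~` V) x by rewrite -OV.
exists (SigSub (mem_set Uy)) => //; apply: contrapT => nV; apply: nOy.
by have : (~` V) (SigSub (mem_set Uy)) by []; rewrite -OV.
Qed.

Lemma zero_dim_homeo (X Y : topologicalType) (f : X -> Y) (g : Y -> X) :
  continuous f -> continuous g -> cancel f g -> cancel g f ->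
  zero_dim X -> zero_dim Y.
Proof.
move=> fc gc fK gK [D [Dop Dnb] Dcl]; exists [set g @^-1` V | V in D].
  split=> [_ [V DV <-]|y A Ay].
    by move/continuousP: gc; apply; exact: Dop.
  rewrite -(gK y) in Ay; have [V [DV Vgy] VA] := Dnb (g y) _ (fc _ _ Ay).
  exists (g @^-1` V); first by split => //; exists V.
  by move=> z /VA /=; rewrite gK.
move=> _ [V DV <-]; have [oV cV] := Dcl _ DV; split.
  by move/continuousP: gc; apply.
exact: closed_preim gc cV.
Qed.

End Topology.

(** * Homomorphisms, embeddings and subuniverses *)

Section Homs.
Context {S : signature}.
Implicit Types A B C : structure S.

(** Partial operations take a proof of definedness, so replacing the tuple also changes the type of
    that proof; proof irrelevance absorbs the change. *)
Lemma pop_eq (T : Type) (s : structure_on S T) i t t'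
    (d : pdom s i t) (d' : pdom s i t') : t = t' -> pop s d = pop s d'.
Proof. by move=> tt'; subst t'; congr (pop s _); exact: Prop_irrelevance. Qed.

Lemma hom_id A : hom (@idfun A).
Proof. by split=> // i t d; exists d. Qed.

Lemma hom_comp A B C (f : A -> B) (g : B -> C) :
  hom f -> hom g -> hom (g \o f).
Proof.
move=> [fo fp fr] [go gp gr]; split=> [i t|i t d|i t r] /=.
- by rewrite fo go.
- have [d1 e1] := fp _ _ d; have [d2 e2] := gp _ _ d1.
  by exists d2; rewrite e1 e2.
- exact/gr/fr.
Qed.

Lemma hom_proj (I : Type) (K : I -> structure S) (j : I) :
  hom ((fun x => x j) : prod_str K -> K j).
Proof. by split=> // i t d; exists (d j). Qed.

Lemma hom_tuple A (I : Type) (K : I -> structure S) (f : A -> prod_str K) :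
  (forall j, hom (fun a => f a j)) -> hom f.
Proof.
move=> fh; split=> [i t|i t d|i t r].
- by apply: functional_extensionality_dep => j; have [+ _ _] := fh j; apply.
- have d' : pdom (str (prod_str K)) i (f \o t).
    by move=> j; have [_ /(_ i t d)[] + _ _] := fh j.
  exists d'; apply: functional_extensionality_dep => j /=.
  have [_ /(_ i t d)[e ->] _] := fh j; exact: pop_eq.
- by move=> j; have [_ _] := fh j; apply.
Qed.

Lemma hom_val B (U : set B) (hU : subuniverse U) :
  hom (val : sub_str hU -> B).
Proof. by split=> // i t d; exists d. Qed.

Lemma hom_sub A B (U : set B) (hU : subuniverse U) (f : A -> sub_str hU) :
  hom ((val : sub_str hU -> B) \o f) -> hom f.
Proof.
move=> [fo fp fr]; split=> [i t|i t d|i t r].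
- exact/val_inj/fo.
- by have [d' e] := fp i t d; exists d'; apply: val_inj; exact: e.
- exact: fr.
Qed.

(** A tuple in the range lifts to [A]. Reflection of domains makes a partial operation defined on
    the lift, so the range is closed under it; with reflection of relations, the inverse is a
    homomorphism too. *)
Lemma strict_hom_embedding A B (f : A -> B) : hom f -> injective f ->
  (forall i t, pdom (str B) i (f \o t) -> pdom (str A) i t) ->
  (forall i t, srel (str B) i (f \o t) -> srel (str A) i t) ->
  embedding f.
Proof.
move=> fh finj fpd frel; have [fo fp fr] := fh.
have hU : subuniverse (range f).
  split=> [i t ht|i t + ht].
    have tE : t = f \o (fun k => projT1 (cid2 (ht k))).
      by apply/funext => k /=; case: cid2.
    by rewrite tE -fo; exact: imageT.
  have tE : t = f \o (fun k => projT1 (cid2 (ht k))).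
    by apply/funext => k /=; case: cid2.
  rewrite tE => d; have [d' e] := fp i _ (fpd _ _ d).
  by rewrite (pop_eq d d') // -e; exact: imageT.
pose g a : sub_str hU := SigSub (mem_set (imageT f a)).
pose g' (u : sub_str hU) : A := projT1 (cid2 (set_valP u)).
have g'E u : f (g' u) = val u by rewrite /g'; case: cid2.
have fg'E n (t : 'I_n -> sub_str hU) : f \o (g' \o t) = val \o t.
  by apply/funext => k /=; rewrite g'E.
exists (range f), hU, g; split=> //; split; first exact: hom_sub.
exists g'; split=> [|a|u]; last exact/val_inj/g'E.
  split=> [i t|i t d|i t r].
  - by apply: finj; rewrite g'E fo fg'E.
  - have d' : pdom (str A) i (g' \o t) by apply: fpd; rewrite fg'E.
    exists d'; apply: finj; rewrite g'E.
    by have [e ->] := fp i _ d'; apply: pop_eq; rewrite fg'E.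
  - by apply: frel; rewrite fg'E.
by apply: finj; rewrite g'E.
Qed.

Lemma iso_reflects_pdom A B (f : A -> B) : iso f ->
  forall i t, pdom (str B) i (f \o t) -> pdom (str A) i t.
Proof.
move=> [_ [g [[_ gp _] fK _]]] i t /gp[+ _].
by rewrite compA (_ : g \o f = id) //; apply/funext.
Qed.

Lemma iso_reflects_srel A B (f : A -> B) : iso f ->
  forall i t, srel (str B) i (f \o t) -> srel (str A) i t.
Proof.
move=> [_ [g [[_ _ gr] fK _]]] i t /gr.
by rewrite compA (_ : g \o f = id) //; apply/funext.
Qed.

Lemma subuniverse_preim A B (f : A -> B) (U : set B) :
  hom f -> subuniverse U -> subuniverse (f @^-1` U).
Proof.
move=> [fo fp _] [Uo Up]; split=> [i t ht|i t d ht] /=.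
  by rewrite fo; apply: Uo.
by have [d' ->] := fp i t d; apply: Up.
Qed.

Lemma subuniverse_equalizer A B (f g : A -> B) :
  hom f -> hom g -> subuniverse [set x | f x = g x].
Proof.
move=> [fo fp _] [go gp _].
split=> [i t ht|i t d ht] /=.
  by rewrite fo go; congr op; apply/funext.
have [d1 ->] := fp i t d; have [d2 ->] := gp i t d.
by apply: pop_eq; apply/funext.
Qed.

Lemma subuniverse_val_image B (U : set B) (hU : subuniverse U)
    (V : set (sub_str hU)) :
  subuniverse V -> subuniverse [set val x | x in V].
Proof.
move=> [Vo Vp].
have lift n (t : 'I_n -> B) : (forall k, [set val x | x in V] (t k)) ->
    exists2 t' : 'I_n -> sub_str hU, t = val \o t' & forall k, V (t' k).
  move=> ht; exists (fun k => projT1 (cid2 (ht k))).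
    by apply/funext => k /=; case: cid2.
  by move=> k; case: cid2.
split=> [i t /lift[t' -> Vt']|i t + /lift[t' tE Vt']].
  by exists (op (str (sub_str hU)) i t') => //; exact: Vo.
rewrite tE => d.
by exists (@pop _ _ (str (sub_str hU)) i t' d) => //; exact: Vp.
Qed.

End Homs.

(** * Continuous homomorphisms and closed generation *)

Section TopHoms.
Context {S : signature}.
Implicit Types B C D : topStructure S.

Lemma chom_comp B C D (f : B -> C) (g : C -> D) :
  chom f -> chom g -> chom (g \o f).
Proof.
move=> [fh fc] [gh gc]; split; last exact: comp_cont.
exact: (@hom_comp S (flat B) (flat C) (flat D)).
Qed.

Lemma chom_id B : chom (@idfun B).
Proof. by split; [exact: (@hom_id S (flat B)) | move=> x]. Qed.

Lemma tiso_comp B C D (f : B -> C) (g : C -> D) :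
  tiso f -> tiso g -> tiso (g \o f).
Proof.
move=> [fh [f' [f'h fK f'K]]] [gh [g' [g'h gK g'K]]].
split; first exact: chom_comp.
exists (f' \o g'); split; first exact: chom_comp.
  exact: can_comp.
exact: can_comp.
Qed.

(** The equalizer of [f] and [g] is a closed subuniverse containing [E], hence everything. *)
Lemma chom_eq B C (E : set B) (f g : B -> C) : hausdorff_space C ->
  cgen E = setT -> chom f -> chom g -> {in E, f =1 g} -> f = g.
Proof.
move=> hC genE [fh fc] [gh gc] fg; apply/funext => x.
have /(_ [set y | f y = g y]) : cgen E x by rewrite genE.
apply; first exact: closed_equalizer.
  exact: (@subuniverse_equalizer S (flat B) (flat C)).
by move=> y /mem_set; exact: fg.
Qed.

Lemma closed_cgen B (E : set B) : closed (cgen E).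
Proof.
rewrite (_ : cgen E = \bigcap_(U in [set U : set B | [/\ closed U,
    subuniverse (U : set (flat B)) & E `<=` U]]) U).
  by apply: closed_bigI => U [].
apply/seteqP; split=> x h; first by move=> U [cU hU EU]; exact: h.
by move=> U cU hU EU; exact: h.
Qed.

Lemma chom_cgen_sub B C (E : set B) (U : set C) (f : B -> C) :
  closed U -> subuniverse (U : set (flat C)) -> chom f ->
  E `<=` f @^-1` U -> cgen E `<=` f @^-1` U.
Proof.
move=> cU hU [fh fc] EU x; apply=> //; first exact: closed_preim fc cU.
exact: (@subuniverse_preim S (flat B) (flat C)).
Qed.

(** Since [cgen E] is closed, a closed subuniverse [V] of it that contains [E] is still a closed
    subuniverse when viewed in [B]; minimality of [cgen E] then forces [V] to be everything. *)
Lemma cgen_in_cgen B (E : set B) :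
  cgen ([set x | E (val x)] : set (tsub (cgen_sub E))) = setT.
Proof.
apply/seteqP; split=> // x _ V cV hV EV.
have : [set val y | y in V] (val x).
  apply: (set_valP x [set val y | y in V]).
  - exact: (@closed_val_image B _ V (@closed_cgen B E) cV).
  - exact: (@subuniverse_val_image S (flat B) _ (cgen_sub E) V hV).
  - by move=> y Ey; exists (SigSub (mem_set (cgen_incl Ey))) => //; exact: EV.
by move=> [y Vy /val_inj <-].
Qed.

End TopHoms.

(** * Change of class and uniqueness of Bohr compactifications *)

Section BohrTheory.
Context {S : signature}.
Variable A : structure S.

Lemma bohr_subclass (C C' : topStructure S -> Prop) (B : topStructure S)
    (i : A -> B) :
  (forall X, C' X -> C X) -> C' B -> bohr C i -> bohr C' i.
Proof.
move=> sub CB [_ emb gen univ]; split=> // X /sub; exact: univ.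
Qed.

Lemma bohr_hom (C : topStructure S -> Prop) (B : topStructure S) (i : A -> B) :
  bohr C i -> hom (i : A -> flat B).
Proof.
move=> [_ [U [hU [g [[gh _] iE]]]] _ _].
rewrite (_ : i = (val : sub_str hU -> flat B) \o g); last exact/funext.
exact: hom_comp (hom_val hU).
Qed.

Lemma bohr_unique (C : topStructure S -> Prop) (B B' : topStructure S)
    (i : A -> B) (i' : A -> B') : bohr C i -> bohr C i' -> same_ext i i'.
Proof.
(* Both [f] and the identity extend [k] along [k], so the uniqueness clause identifies them; this is
   applied to the two composites of the induced maps. *)
have self (D : topStructure S) (k : A -> D) (f : D -> D) :
    bohr C k -> chom f -> f \o k = k -> f = idfun.
  move=> bk fh fk; have [h [_ hu]] := bohr_univ bk (bohr_in bk) (bohr_hom bk).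
  by rewrite -(hu f) // -(hu idfun) //; split=> //; exact: chom_id.
move=> bi bi'.
have [f [[fh fi] _]] := bohr_univ bi (bohr_in bi') (bohr_hom bi').
have [g [[gh gi'] _]] := bohr_univ bi' (bohr_in bi) (bohr_hom bi).
have gf : g \o f = idfun.
  by apply: self bi _ _; [exact: chom_comp | rewrite -compA fi].
have fg : f \o g = idfun.
  by apply: self bi' _ _; [exact: chom_comp | rewrite -compA gi'].
exists f; split=> //; split=> //; exists g; split=> // x.
  exact: (congr1 (@^~ x) gf).
exact: (congr1 (@^~ x) fg).
Qed.

End BohrTheory.

(** * The natural extension as reflection into [IScP M] *)

Section NaturalExtensionTheory.
Context {S : signature} {J : Type}.
Variable M : J -> topStructure S.
Hypothesis hausM : forall j, hausdorff_space (M j).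

Lemma IScP_hausdorff (B : topStructure S) : IScP M B -> hausdorff_space B.
Proof.
move=> [I [m [U [hU [f [_ _ [[_ fc] [g [_ fK _]]]]]]]]].
apply: (@hausdorff_separating B I _ (fun i x => val (f x) i)) => // [i|x y xy].
  exact (comp_cont fc (comp_cont (@sub_topology_val _ U)
    (@prod_topology_eval I (fun i => tcar (M (m i))) i))).
by apply: (can_inj fK); apply: val_inj; exact: functional_extensionality_dep.
Qed.

Lemma IScP_tiso (B C : topStructure S) (f : B -> C) :
  tiso f -> IScP M C -> IScP M B.
Proof.
move=> fi [I [m [U [hU [g [U0 cU gi]]]]]].
exists I, m, U, hU, (g \o f); split=> //; exact: tiso_comp.
Qed.

Lemma ABt_tiso (B C : topStructure S) (f : B -> C) :
  tiso f -> Act M B -> ABt M C -> ABt M B.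
Proof.
move=> [[_ fc] [g [[_ gc] fK gK]]] AB [_ zC]; split=> //.
exact: zero_dim_homeo gc fc gK fK zC.
Qed.

Variable A : structure S.
Hypothesis hA : ISP M A.

Lemma nat_eval_hom : hom (@nat_eval S J M A : A -> flat (tprod _)).
Proof.
by apply: (@hom_tuple S A _ (fun x => flat (natY x))) => x; exact: svalP.
Qed.

Lemma nat_emb_hom : hom (nat_emb M A : A -> flat (nat_ext M A)).
Proof. exact: (@hom_sub S A _ _ (cgen_sub _) (nat_emb M A) nat_eval_hom). Qed.

(* Since [A] embeds in a product of the [M j], homomorphisms into the [M j]
   separate points and reflect relations and domains. *)
Lemma nat_emb_embedding : embedding (nat_emb M A : A -> flat (nat_ext M A)).
Proof.
have [I [m [U [hU [f [_ fi]]]]]] := hA.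
have coord_hom i : hom ((fun a => val (f a) i) : A -> flat (M (m i))).
  exact (hom_comp fi.1 (hom_comp (@hom_val S _ U hU)
    (@hom_proj S I (fun i => flat (M (m i))) i))).
(* Each coordinate of the given representation of [A] is an index of the product containing the
   natural extension. *)
pose coord i : natX M A := existT _ (m i) (exist _ _ (coord_hom i)).
apply: strict_hom_embedding; first exact: nat_emb_hom.
- move=> a b /(congr1 val) ab; have [_ [g [_ fK _]]] := fi.
  apply: (can_inj fK); apply: val_inj; apply: functional_extensionality_dep.
  move=> i.
  exact (congr1 (fun z : forall x, @natY S J M A x => z (coord i)) ab).
- move=> i t d; apply: (iso_reflects_pdom fi); rewrite /= => k; exact: (d (coord k)).
- move=> i t d; apply: (iso_reflects_srel fi); rewrite /= => k; exact: (d (coord k)).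
Qed.

Lemma nat_ext_IScP : IScP M (nat_ext M A).
Proof.
exists (natX M A), (@projT1 _ _), (cgen (range (@nat_eval S J M A))),
  (cgen_sub _), idfun; split.
(* Nonemptiness: a point of [U] pulls back to an element [a] of [A]. *)
- have [I [m [U [hU [f [[u Uu] [_ [g _]]]]]]]] := hA.
  pose a := g (SigSub (mem_set Uu)).
  by exists (nat_eval a); apply: cgen_incl; exact: imageT.
- exact: closed_cgen.
- by split; [exact: chom_id | exists idfun; split=> //; exact: chom_id].
Qed.

Lemma cgen_nat_emb : cgen (range (nat_emb M A)) = setT.
Proof.
rewrite -(cgen_in_cgen (range (@nat_eval S J M A))); congr cgen.
apply/seteqP; split=> [_ [a _ <-]|x [a _ ax]]; first by exists a.
by exists a => //; exact: val_inj.
Qed.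

Lemma nat_emb_extend (B : topStructure S) (g : A -> flat B) :
  IScP M B -> hom g ->
  exists h : nat_ext M A -> B, chom h /\ h \o nat_emb M A = g.
Proof.
move=> [I [m [U [hU [f [_ cU [[fh fc] [f' [f'h fK f'K]]]]]]]]] gh.
pose P := tprod (fun i => M (m i)).
have coord_hom i : hom ((fun a => val (f (g a)) i) : A -> flat (M (m i))).
  exact (hom_comp gh (hom_comp fh (hom_comp (@hom_val S (flat P) U hU)
    (@hom_proj S I (fun i => flat (M (m i))) i)))).
pose coord i : natX M A := existT _ (m i) (exist _ _ (coord_hom i)).
pose proj (z : tprod (@natY _ _ M A)) : P := fun i => z (coord i).
have projh : chom proj.
  split.
    apply: (@hom_tuple S _ I (fun i => flat (M (m i)))) => i.
    exact: (@hom_proj S _ (fun x => flat (natY x)) (coord i)).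
  apply: prod_topology_cont => i.
  exact: (@prod_topology_eval _ (fun x => tcar (@natY _ _ M A x)) (coord i)).
(* [proj] sends [nat_eval a] to [val (f (g a))], which lies in [U]; the closed subuniverse generated
   by these points follows. *)
have projU : cgen (range (@nat_eval S J M A)) `<=` proj @^-1` U.
  by apply: chom_cgen_sub => // _ [a _ <-]; exact: (set_valP (f (g a))).
pose k (z : nat_ext M A) : tsub hU :=
  SigSub (mem_set (projU _ (set_valP z) : U (proj (val z)))).
have kh : chom k.
  split.
    exact (@hom_sub S (flat (nat_ext M A)) (flat P) U hU k
      (hom_comp (@hom_val S (flat (tprod (@natY S J M A))) _ (cgen_sub _))
         projh.1)).
  apply: sub_topology_cont.
  exact (comp_cont (@sub_topology_val _ _) projh.2).
(* On the image of [A] the map [k] agrees with [f \o g], and [f'] undoes [f]. *)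
exists (f' \o k); split; first exact: chom_comp.
apply/funext => a /=; rewrite -[RHS]fK; congr f'.
exact: val_inj.
Qed.

Lemma nat_ext_bohr : bohr (IScP M) (nat_emb M A).
Proof.
split; [exact: nat_ext_IScP|exact: nat_emb_embedding|exact: cgen_nat_emb|].
move=> B MB g gh; have [h [hh hg]] := nat_emb_extend MB gh.
exists h; split=> // h' [h'h h'g].
(* Uniqueness: both extensions agree on the generating image of [A], and the target is Hausdorff. *)
apply: (chom_eq (IScP_hausdorff MB) cgen_nat_emb) => // _ /set_mem[a _ <-].
by have /(congr1 (@^~ a)) := etrans hg (esym h'g).
Qed.

End NaturalExtensionTheory.

(** * Comparison of the three extensions *)

Theorem proposition4p1 (S : signature) (J : Type) (M : J -> topStructure S)
    (hM : ct_prevariety M) :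
  [/\ (forall B : topStructure S, IScP M B <-> Act M B) ->
      forall A : structure S, ISP M A ->
        (exists (b : topStructure S) (iota : A -> b), bohr (Act M) iota) /\
        (forall (b : topStructure S) (iota : A -> b), bohr (Act M) iota ->
          same_ext iota (nat_emb M A)),
      (forall B : topStructure S, IScP M B <-> ABt M B) ->
      forall A : structure S, ISP M A ->
        (exists (b0 : topStructure S) (iota0 : A -> b0), bohr (ABt M) iota0) /\
        (forall (b0 : topStructure S) (iota0 : A -> b0), bohr (ABt M) iota0 ->
          same_ext iota0 (nat_emb M A))
    & forall A : structure S, ISP M A ->
        ((forall B : topStructure S, IScP M B -> ABt M B) ->
          forall (b0 : topStructure S) (iota0 : A -> b0),
            bohr (ABt M) iota0 ->
            (same_ext iota0 (nat_emb M A) <-> IScP M b0)) /\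
        (forall (b b0 : topStructure S) (iota : A -> b) (iota0 : A -> b0),
          bohr (Act M) iota -> bohr (ABt M) iota0 ->
          (same_ext iota iota0 <-> ABt M b))].
Proof.
have natB A : ISP M A -> bohr (IScP M) (nat_emb M A).
  by apply: nat_ext_bohr => j; exact: (hM j).2.
have natC C A : (forall B, IScP M B <-> C B) -> ISP M A ->
    (exists (b : topStructure S) (iota : A -> b), bohr C iota) /\
    (forall (b : topStructure S) (iota : A -> b), bohr C iota ->
      same_ext iota (nat_emb M A)).
  (* When the classes coincide, the natural extension is itself a compactification relative to [C],
     which also settles existence. *)
  move=> MC hA; have nC : bohr C (nat_emb M A).
    apply: bohr_subclass (natB A hA) => [X /MC //|].
    exact/MC/(bohr_in (natB A hA)).
  split; first by exists (nat_ext M A), (nat_emb M A).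
  by move=> b iota bi; exact: bohr_unique bi nC.
split=> [MC A|MC A|A hA]; [exact: natC|exact: natC|split].
  (* Forwards, membership in [IScP M] transfers along the isomorphism. Backwards, [b0] becomes a
     compactification relative to the subclass [IScP M], as the natural extension is. *)
  move=> MB b0 iota0 bi0; split=> [[f [fi _]]|Mb0].
    exact: IScP_tiso fi (bohr_in (natB A hA)).
  by apply: bohr_unique (natB A hA); exact: bohr_subclass bi0.
(* The same scheme, with [ABt M] as a subclass of [Act M]. *)
move=> b b0 iota iota0 bi bi0; split=> [[f [fi _]]|Bb].
  exact: ABt_tiso fi (bohr_in bi) (bohr_in bi0).
by apply: bohr_unique bi0; apply: bohr_subclass bi => // X [].
Qed.
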